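(* Let $a,k,\gamma,q_0>0$ be constants, and let $\beta,\delta$ be real constants with $\beta\ge\delta$ and $\beta+\delta+1>0$. Put $\alpha=\beta-\delta$. Then there exists a unique solution $(u_N,s_N)$ of similarity type to the free boundary problem $(P_N)$ with Neumann condition: $$\frac{\partial u}{\partial t}=a^2\frac{\partial^2u}{\partial x^2}\quad(0<x<s(t),\ t>0),\qquad u(s(t),t)=0\quad (t>0),$$ $$-k\frac{\partial u}{\partial x}(s(t),t)=\gamma\, s^{\beta}(t)\,\dot s^{\delta}(t)\,\dot s(t)\quad (t>0),\qquad s(0)=0,$$ $$k\frac{\partial u}{\partial x}(0,t)=-q_0t^{\frac{\alpha-1}{2}}\quad (t>0).$$ It is given by $$u_N(x,t)=t^{\alpha/2}\left[C_{1N}M\left(-\tfrac{\alpha}{2},\tfrac12,-\eta^2\right)+C_{2N}\,\eta\, M\left(-\tfrac{\alpha}{2}+\tfrac12,\tfrac32,-\eta^2\right)\right],\quad \eta=\frac{x}{2a\sqrt t},\qquad s_N(t)=2\xi_Na\sqrt t,$$ where $$C_{1N}=\frac{2aq_0\xi_N}{k}\,\frac{M(-\frac{\alpha}{2}+\frac12,\frac32,-\xi_N^2)}{M(-\frac{\alpha}{2},\frac12,-\xi_N^2)},\qquad C_{2N}=-\frac{2aq_0}{k},$$ and $\xi_N$ is the unique positive solution of the equation $$\frac{q_0}{\gamma2^{\beta}a^{\beta+\delta+1}}\,g(z)=z^{\beta+\delta+1},\quad z>0,\qquad g(z)=\frac{1}{M(\frac{\alpha}{2}+\frac12,\frac12,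z^2)}.$$
   Context: $M$ is Kummer's confluent hypergeometric function of the first kind, $M(p,q,z)=\sum_{n=0}^{\infty}\frac{(p)_n}{(q)_n}\frac{z^n}{n!}$, with $(p)_0=1$, $(p)_n=p(p+1)\cdots(p+n-1)$ ($q$ not a non-positive integer). The dot denotes $d/dt$. The unknowns of the problem are the function $u=u(x,t)$, $0\le x\le s(t)$, $t>0$, and the moving boundary $x=s(t)$. A solution $(u,s)$ is of similarity type if $u(x,t)=t^{\alpha/2}\varphi(\eta)$ with $\eta=\frac{x}{2a\sqrt t}$ for a function $\varphi$ twice continuously differentiable on $[0,\xi]$, and $s(t)=2\xi a\sqrt t$ for a constant $\xi>0$. *)

(* Defs.v *)
From Stdlib Require Import Reals Factorial.
From Coquelicot Require Import Coquelicot.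
Open Scope R_scope.

(** Stdlib's [D_in f f' D x] says that [f] is differentiable at [x] relative to
    [D], with derivative [f' x]; on a closed interval it is the one-sided
    derivative at the endpoints. *)

Fixpoint pochhammer (p : R) (n : nat) : R :=
  match n with
  | O => 1
  | S m => pochhammer p m * (p + INR m)
  end.

Definition kummerM (p q z : R) : R :=
  PSeries (fun n => pochhammer p n / pochhammer q n / INR (fact n)) z.

Definition g (alpha z : R) : R := / kummerM (alpha / 2 + 1 / 2) (1 / 2) (z ^ 2).

Definition closed_interval (l r : R) : R -> Prop := fun x => l <= x <= r.

Definition C2_on (l r : R) (phi : R -> R) : Prop :=
  exists phi1 phi2 : R -> R,
    forall x, l <= x <= r ->
      D_in phi phi1 (closed_interval l r) x /\
      D_in phi1 phi2 (closed_interval l r) x /\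
      continue_in phi2 (closed_interval l r) x.

(** [u] and [s] are total functions, but only the values [u x t] with [0 < t],
    [0 <= x <= s t], and [s t] with [0 <= t], are meaningful. *)

(** The real powers in the Stefan condition are [Rpower], which is the usual
    power only for a positive base; on solutions of similarity type both [s t]
    and its derivative are positive. *)
Definition solves_PN (a k gamma q0 beta delta : R)
    (u : R -> R -> R) (s : R -> R) : Prop :=
  exists (ux uxx ut : R -> R -> R) (ds : R -> R),
    (forall x t, 0 < t -> 0 <= x <= s t ->
       D_in (fun y => u y t) (fun y => ux y t) (closed_interval 0 (s t)) x) /\
    (forall x t, 0 < t -> 0 < x < s t ->
       is_derive (fun y => ux y t) x (uxx x t) /\
       is_derive (fun tau => u x tau) t (ut x t)) /\
    (forall t, 0 < t -> is_derive s t (ds t)) /\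
    (forall x t, 0 < t -> 0 < x < s t -> ut x t = a ^ 2 * uxx x t) /\
    (forall t, 0 < t -> u (s t) t = 0) /\
    (forall t, 0 < t ->
       - k * ux (s t) t
       = gamma * Rpower (s t) beta * Rpower (ds t) delta * ds t) /\
    s 0 = 0 /\
    (forall t, 0 < t ->
       k * ux 0 t = - q0 * Rpower t ((beta - delta - 1) / 2)).

Definition similarity_type (a alpha : R) (u : R -> R -> R) (s : R -> R) : Prop :=
  exists (xi : R) (phi : R -> R),
    0 < xi /\ C2_on 0 xi phi /\
    (forall t, 0 <= t -> s t = 2 * xi * a * sqrt t) /\
    (forall x t, 0 < t -> 0 <= x <= s t ->
       u x t = Rpower t (alpha / 2) * phi (x / (2 * a * sqrt t))).

(* Main.v *)
(* With [u x t = t^(alpha/2) P (x / (2 a sqrt t))] the problem becomes the ODE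
   [P'' + 2 x P' - 2 alpha P = 0] on [[0, xi]] with [P xi = 0], [P' 0] prescribed
   by the flux, and the Stefan condition on [P' xi]. One solution of the ODE is
   [H x = exp (- x^2) M(alpha/2 + 1/2, 1/2, x^2)], which is positive because the
   series has nonnegative terms, and satisfies [H 0 = 1], [H' 0 = 0]. Since
   [exp (x^2) (P' H - P H')] is constant, [P xi = 0] forces
   [P' xi = P' 0 * g xi], so the Stefan condition is the equation for [xi], whose
   two sides are decreasing and increasing. The same Wronskian shows that a
   solution with [P' 0 = 0] is a multiple of [H], hence uniqueness of [P] and the
   identity [M(- alpha/2, 1/2, - x^2) = H x] that makes [C1N] well defined. *)

Require Import Defs.
From Stdlib Require Import Reals Factorial Arith Lra Ranalysis5.
From Coquelicot Require Import Coquelicot.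
Open Scope R_scope.

(** * Kummer's series: convergence everywhere, differential equation, monotonicity *)

Definition kummer_coef (p q : R) (n : nat) : R :=
  pochhammer p n / pochhammer q n / INR (fact n).

Lemma pochhammer_pos (q : R) (n : nat) : 0 < q -> 0 < pochhammer q n.
Proof.
intros hq; induction n as [|n IH]; simpl; [lra|].
apply Rmult_lt_0_compat; [exact IH|].
pose proof (pos_INR n); lra.
Qed.

Lemma kummer_coef_S (p q : R) (n : nat) : 0 < q ->
  kummer_coef p q (S n) =
  kummer_coef p q n * ((p + INR n) / ((q + INR n) * INR (S n))).
Proof.
intros hq; unfold kummer_coef.
pose proof (pos_INR n); pose proof (pochhammer_pos q n hq).
pose proof (INR_fact_neq_0 n).
assert (INR (S n) <> 0) by (apply not_0_INR; discriminate).
change (fact (S n)) with (S n * fact n)%nat; rewrite mult_INR.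
cbn [pochhammer].
field; repeat split; lra.
Qed.

(** The ratio of consecutive coefficients is at most [(Rabs p / q + 1) / INR (S n)], because
    [Rabs p + n <= (Rabs p / q + 1) * (q + n)]; induction multiplies these bounds. *)
Lemma kummer_coef_bound (p q : R) (n : nat) : 0 < q ->
  Rabs (kummer_coef p q n) <= (Rabs p / q + 1) ^ n / INR (fact n).
Proof.
intros hq.
assert (hpq : 0 <= Rabs p / q).
{ apply Rdiv_le_0_compat; [apply Rabs_pos | exact hq]. }
induction n as [|n IH].
- unfold kummer_coef; simpl; rewrite Rabs_pos_eq; lra.
- rewrite kummer_coef_S by exact hq; rewrite Rabs_mult.
  pose proof (pos_INR n).
  assert (hS : 0 < INR (S n)) by (apply lt_0_INR; apply Nat.lt_0_succ).
  assert (hr : Rabs ((p + INR n) / ((q + INR n) * INR (S n)))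
               <= (Rabs p / q + 1) / INR (S n)).
  { assert (hd : 0 < (q + INR n) * INR (S n)) by (apply Rmult_lt_0_compat; lra).
    unfold Rdiv at 1; rewrite Rabs_mult, Rabs_inv.
    rewrite (Rabs_pos_eq ((q + INR n) * INR (S n))) by lra.
    apply Rmult_le_reg_r with ((q + INR n) * INR (S n)); [exact hd|].
    replace (Rabs (p + INR n) * / ((q + INR n) * INR (S n))
             * ((q + INR n) * INR (S n))) with (Rabs (p + INR n))
      by (field; split; lra).
    replace ((Rabs p / q + 1) / INR (S n) * ((q + INR n) * INR (S n)))
      with (Rabs p + Rabs p / q * INR n + q + INR n) by (field; split; lra).
    eapply Rle_trans; [apply Rabs_triang|].
    rewrite (Rabs_pos_eq (INR n)) by lra.
    pose proof (Rmult_le_pos _ _ hpq H); lra. }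
  replace ((Rabs p / q + 1) ^ S n / INR (fact (S n))) with
    ((Rabs p / q + 1) ^ n / INR (fact n) * ((Rabs p / q + 1) / INR (S n))).
  + apply Rmult_le_compat; auto using Rabs_pos.
  + change (fact (S n)) with (S n * fact n)%nat; rewrite mult_INR; simpl pow.
    pose proof (INR_fact_neq_0 n); field; repeat split; lra.
Qed.

(** At every [r] the terms are bounded: each is dominated by a term of the exponential series at
    [K * Rabs r], and a single term of that nonnegative series is at most its sum. *)
Lemma CV_radius_kummer (p q : R) : 0 < q -> CV_radius (kummer_coef p q) = p_infty.
Proof.
intros hq.
set (K := Rabs p / q + 1).
assert (hK : 0 <= K).
{ assert (0 <= Rabs p / q)
    by (apply Rdiv_le_0_compat; [apply Rabs_pos | exact hq]); unfold K; lra. }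
assert (hr : forall r, Rbar_le (Finite r) (CV_radius (kummer_coef p q))).
{ intros r; apply (proj1 (CV_radius_bounded (kummer_coef p q))).
  exists (exp (K * Rabs r)); intros n.
  rewrite Rabs_mult, <- RPow_abs.
  apply Rle_trans with ((K * Rabs r) ^ n / INR (fact n)).
  - rewrite Rpow_mult_distr.
    replace (K ^ n * Rabs r ^ n / INR (fact n))
      with (K ^ n / INR (fact n) * Rabs r ^ n) by (unfold Rdiv; ring).
    apply Rmult_le_compat_r; [apply pow_le, Rabs_pos|].
    apply kummer_coef_bound, hq.
  - assert (hx : 0 <= K * Rabs r) by (apply Rmult_le_pos; [exact hK | apply Rabs_pos]).
    assert (hpos : forall m, 0 <= (K * Rabs r) ^ m / INR (fact m)).
    { intros m; apply Rdiv_le_0_compat; [apply pow_le, hx | apply INR_fact_lt_0]. }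
    pose proof (is_exp_Reals (K * Rabs r)) as hs.
    apply is_pseries_R in hs.
    assert (hn : (K * Rabs r) ^ n / INR (fact n)
            <= sum_n (fun m => / INR (fact m) * (K * Rabs r) ^ m) n).
    { destruct n as [|n].
      - rewrite sum_O; lra.
      - rewrite sum_Sn; unfold plus; simpl.
        assert (0 <= sum_n (fun m => / INR (fact m) * (K * Rabs r) ^ m) n).
        { clear -hpos; induction n as [|n IH].
          - rewrite sum_O; specialize (hpos O); lra.
          - rewrite sum_Sn; unfold plus; simpl; simpl in IH.
            specialize (hpos (S n)); simpl in hpos; lra. }
        simpl in *; lra. }
    eapply Rle_trans; [exact hn|].
    apply (is_lim_seq_incr_compare _ _ hs).
    intros m; rewrite sum_Sn; unfold plus; simpl.
    specialize (hpos (S m)); simpl in hpos; lra. }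
destruct (CV_radius (kummer_coef p q)) as [r| |]; [|reflexivity|].
- specialize (hr (r + 1)); simpl in hr; lra.
- destruct (hr 0).
Qed.

(** The derivatives in [z] are kept as power series, so that Kummer's equation can be checked
    coefficient by coefficient. *)
Definition kummerM1 (p q z : R) : R := PSeries (PS_derive (kummer_coef p q)) z.

Definition kummerM2 (p q z : R) : R :=
  PSeries (PS_derive (PS_derive (kummer_coef p q))) z.

Lemma is_derive_kummerM (p q z : R) : 0 < q ->
  is_derive (kummerM p q) z (kummerM1 p q z).
Proof.
intros hq; apply (is_derive_PSeries (kummer_coef p q)).
rewrite CV_radius_kummer by exact hq; exact I.
Qed.

Lemma is_derive_kummerM1 (p q z : R) : 0 < q ->
  is_derive (kummerM1 p q) z (kummerM2 p q z).
Proof.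
intros hq; apply is_derive_PSeries.
rewrite CV_radius_derive, CV_radius_kummer by exact hq; exact I.
Qed.

(** With [c] the coefficients, [z M'' + q M'] has n-th coefficient [(n + 1) (q + n) c (n + 1)] and
    [z M' + p M] has [(p + n) c n]; these agree by the recurrence [kummer_coef_S]. *)
Lemma kummer_ode (p q z : R) : 0 < q ->
  z * kummerM2 p q z + (q - z) * kummerM1 p q z = p * kummerM p q z.
Proof.
intros hq.
set (c := kummer_coef p q).
assert (hex : forall a, CV_radius a = p_infty -> ex_pseries a z).
{ intros b hb; apply CV_radius_inside; rewrite hb; exact I. }
assert (h0 : CV_radius c = p_infty) by (apply CV_radius_kummer, hq).
assert (h1 : CV_radius (PS_derive c) = p_infty) by (rewrite CV_radius_derive; exact h0).
assert (h2 : CV_radius (PS_derive (PS_derive c)) = p_infty)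
  by (rewrite CV_radius_derive; exact h1).
assert (e : PSeries (PS_plus (PS_incr_1 (PS_derive (PS_derive c)))
                             (PS_scal q (PS_derive c))) z
          = PSeries (PS_plus (PS_incr_1 (PS_derive c)) (PS_scal p c)) z).
{ apply PSeries_ext; intros n.
  unfold PS_plus, PS_scal, plus, scal; simpl; unfold mult; simpl.
  destruct n as [|n]; unfold PS_incr_1, PS_derive, c.
  - rewrite (kummer_coef_S p q 0) by exact hq; change zero with 0; simpl; field; lra.
  - pose proof (pos_INR n).
    rewrite (kummer_coef_S p q (S n)) by exact hq.
    rewrite !S_INR; field; lra. }
rewrite !PSeries_plus in e; try rewrite !PSeries_incr_1 in e;
  try rewrite !PSeries_scal in e.
- change (PSeries (PS_derive (PS_derive c)) z) with (kummerM2 p q z) in e.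
  change (PSeries (PS_derive c) z) with (kummerM1 p q z) in e.
  change (PSeries c z) with (kummerM p q z) in e.
  lra.
- apply ex_pseries_incr_1, hex, h1.
- apply ex_pseries_scal; [apply Rmult_comm | apply hex, h0].
- apply ex_pseries_incr_1, hex, h2.
- apply ex_pseries_scal; [apply Rmult_comm | apply hex, h1].
Qed.

Lemma kummerM_0 (p q : R) : kummerM p q 0 = 1.
Proof. unfold kummerM; rewrite PSeries_0; simpl; field. Qed.

Lemma kummerM_le (p q x y : R) : 0 < p -> 0 < q -> 0 <= x <= y ->
  kummerM p q x <= kummerM p q y.
Proof.
intros hp hq hxy; apply Series_le.
- intros n.
  assert (0 <= pochhammer p n / pochhammer q n / INR (fact n)).
  { apply Rdiv_le_0_compat; [apply Rdiv_le_0_compat|];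
      auto using pochhammer_pos, INR_fact_lt_0.
    apply Rlt_le, pochhammer_pos, hp. }
  split.
  + apply Rmult_le_pos; [assumption|]; apply pow_le; tauto.
  + apply Rmult_le_compat_l; [assumption|]; apply pow_incr; exact hxy.
- apply (ex_pseries_R (kummer_coef p q)), CV_radius_inside.
  rewrite CV_radius_kummer by exact hq; exact I.
Qed.

Lemma kummerM_ge_1 (p q x : R) : 0 < p -> 0 < q -> 0 <= x -> 1 <= kummerM p q x.
Proof.
intros hp hq hx; rewrite <- (kummerM_0 p q); apply kummerM_le; lra.
Qed.

(** * The profile equation: Wronskian and proportional solutions *)

Lemma is_derive_eq (f : R -> R) (x l l' : R) : is_derive f x l -> l = l' -> is_derive f x l'.
Proof. intros h <-; exact h. Qed.

Lemma is_derive_continuous (f : R -> R) (x l : R) : is_derive f x l -> continuous f x.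
Proof. intros h; apply (ex_derive_continuous f); exists l; exact h. Qed.

Lemma is_derive_zero_const (f : R -> R) (l r x y : R) :
  (forall z, l <= z <= r -> continuous f z) ->
  (forall z, l < z < r -> is_derive f z 0) ->
  l <= x <= r -> l <= y <= r -> f x = f y.
Proof.
intros hc hd hx hy.
destruct (MVT_gen f x y (fun _ => 0)) as [c [_ hc']].
- intros z hz; apply hd.
  unfold Rmin, Rmax in hz; destruct (Rle_dec x y); lra.
- intros z hz; apply continuity_pt_filterlim, hc.
  unfold Rmin, Rmax in hz; destruct (Rle_dec x y); lra.
- lra.
Qed.

(** [P1] stands for [P']. A profile given only on [[0, xi]] fits this form after extension by its
    endpoint values: the extension is continuous on the line but may have corners at [0] and [xi],
    so the equation is asked inside only. *)
Definition solves_profile_ode (alpha xi : R) (P P1 : R -> R) : Prop :=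
  (forall x, continuous P x) /\ (forall x, continuous P1 x) /\
  (forall x, 0 < x < xi ->
     is_derive P x (P1 x) /\
     is_derive P1 x (2 * alpha * P x - 2 * x * P1 x)).

(** Abel's identity: the Wronskian satisfies [W' = - 2 x W], and [exp (x ^ 2)] is the integrating
    factor. *)
Lemma profile_wronskian (alpha xi : R) (P P1 Q Q1 : R -> R) (x : R) :
  solves_profile_ode alpha xi P P1 -> solves_profile_ode alpha xi Q Q1 ->
  0 <= x <= xi ->
  exp (x ^ 2) * (P1 x * Q x - P x * Q1 x) = P1 0 * Q 0 - P 0 * Q1 0.
Proof.
intros [cP [cP1 dP]] [cQ [cQ1 dQ]] hx.
rewrite (is_derive_zero_const
  (fun x => exp (x ^ 2) * (P1 x * Q x - P x * Q1 x)) 0 xi x 0); try lra.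
- replace (0 ^ 2) with 0 by ring; rewrite exp_0; ring.
- intros z _; apply (continuous_mult (fun x => exp (x ^ 2))).
  + apply (is_derive_continuous _ _ (exp (z ^ 2) * (2 * z))); auto_derive; [exact I | simpl; ring].
  + apply (continuous_minus (fun x => P1 x * Q x) (fun x => P x * Q1 x)).
    * apply (continuous_mult P1 Q); auto.
    * apply (continuous_mult P Q1); auto.
- intros z hz; destruct (dP z hz) as [d1 d2]; destruct (dQ z hz) as [d3 d4].
  auto_derive.
  + repeat split; eexists; eauto.
  + change (fun x0 => P x0) with P; change (fun x0 => P1 x0) with P1.
    change (fun x0 => Q x0) with Q; change (fun x0 => Q1 x0) with Q1.
    rewrite (is_derive_unique _ _ _ d1), (is_derive_unique _ _ _ d2),
      (is_derive_unique _ _ _ d3), (is_derive_unique _ _ _ d4).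
    simpl; ring.
Qed.

(** The derivative of [P / Q] is the Wronskian over [Q ^ 2], and the Wronskian vanishes because both
    initial slopes do. *)
Lemma profile_proportional (alpha xi : R) (P P1 Q Q1 : R -> R) (x y : R) :
  solves_profile_ode alpha xi P P1 -> solves_profile_ode alpha xi Q Q1 ->
  (forall z, 0 < Q z) -> P1 0 = 0 -> Q1 0 = 0 ->
  0 <= x <= xi -> 0 <= y <= xi -> P x / Q x = P y / Q y.
Proof.
intros hP hQ hpos hP0 hQ0 hx hy.
pose proof hP as [cP [cP1 dP]]; pose proof hQ as [cQ [cQ1 dQ]].
apply (is_derive_zero_const (fun x => P x / Q x) 0 xi x y); auto.
- intros z _; apply (continuous_mult P (fun x => / Q x)); [apply cP|].
  apply (continuous_comp Q Rinv); [apply cQ|].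
  apply continuous_Rinv; pose proof (hpos z); lra.
- intros z hz; destruct (dP z hz) as [d1 d2]; destruct (dQ z hz) as [d3 d4].
  pose proof (hpos z).
  auto_derive.
  + repeat split; try (eexists; eauto); lra.
  + change (fun x0 => P x0) with P; change (fun x0 => Q x0) with Q.
    rewrite (is_derive_unique _ _ _ d1), (is_derive_unique _ _ _ d3).
    assert (hz' : 0 <= z <= xi) by lra.
    pose proof (profile_wronskian _ _ _ _ _ _ z hP hQ hz') as hw.
    rewrite hP0, hQ0 in hw.
    assert (P1 z * Q z - P z * Q1 z = 0).
    { apply (Rmult_eq_reg_l (exp (z ^ 2))); [lra | pose proof (exp_pos (z ^ 2)); lra]. }
    apply (Rmult_eq_reg_r (Q z * Q z)); [|apply Rmult_integral_contrapositive; lra].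
    field_simplify; lra.
Qed.

(** * The even and odd Kummer solutions of the profile equation, and the end slope *)

Definition profileF (alpha x : R) : R := kummerM (- (alpha / 2)) (1 / 2) (- x ^ 2).
Definition profileF1 (alpha x : R) : R :=
  - 2 * x * kummerM1 (- (alpha / 2)) (1 / 2) (- x ^ 2).
Definition profileG (alpha x : R) : R :=
  x * kummerM (- (alpha / 2) + 1 / 2) (3 / 2) (- x ^ 2).
Definition profileG1 (alpha x : R) : R :=
  kummerM (- (alpha / 2) + 1 / 2) (3 / 2) (- x ^ 2)
  - 2 * x ^ 2 * kummerM1 (- (alpha / 2) + 1 / 2) (3 / 2) (- x ^ 2).
(** The form of the even solution in which positivity is visible: for [0 <= alpha] the Kummer
    parameters are positive and the argument [x ^ 2] is nonnegative. *)
Definition profileH (alpha x : R) : R :=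
  exp (- x ^ 2) * kummerM (alpha / 2 + 1 / 2) (1 / 2) (x ^ 2).
Definition profileH1 (alpha x : R) : R :=
  2 * x * exp (- x ^ 2) *
  (kummerM1 (alpha / 2 + 1 / 2) (1 / 2) (x ^ 2)
   - kummerM (alpha / 2 + 1 / 2) (1 / 2) (x ^ 2)).

Lemma Derive_kummerM (p q z : R) : 0 < q -> Derive (fun x => kummerM p q x) z = kummerM1 p q z.
Proof. intros hq; apply is_derive_unique, (is_derive_kummerM p q z hq). Qed.

Lemma Derive_kummerM1 (p q z : R) : 0 < q -> Derive (fun x => kummerM1 p q x) z = kummerM2 p q z.
Proof. intros hq; apply is_derive_unique, (is_derive_kummerM1 p q z hq). Qed.

Ltac derive_kummer :=
  auto_derive;
  [ repeat split; unfold ex_derive;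
    match goal with
    | |- context [kummerM ?p ?q] => eexists; apply (is_derive_kummerM p q); lra
    | |- context [kummerM1 ?p ?q] => eexists; apply (is_derive_kummerM1 p q); lra
    end
  | rewrite ?Derive_kummerM, ?Derive_kummerM1 by lra ].

Lemma is_derive_profileF (alpha x : R) :
  is_derive (profileF alpha) x (profileF1 alpha x).
Proof. unfold profileF, profileF1; derive_kummer; replace (x * (x * 1)) with (x ^ 2) by ring; ring. Qed.

(** Under [z = - x ^ 2], Kummer's equation multiplied by [-4] is the profile equation. *)
Lemma is_derive_profileF1 (alpha x : R) :
  is_derive (profileF1 alpha) x (2 * alpha * profileF alpha x - 2 * x * profileF1 alpha x).
Proof.
unfold profileF, profileF1; derive_kummer; replace (x * (x * 1)) with (x ^ 2) by ring.
assert (hq : 0 < 1 / 2) by lra.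
pose proof (kummer_ode (- (alpha / 2)) (1 / 2) (- x ^ 2) hq); lra.
Qed.

Lemma is_derive_profileG (alpha x : R) :
  is_derive (profileG alpha) x (profileG1 alpha x).
Proof. unfold profileG, profileG1; derive_kummer; replace (x * (x * 1)) with (x ^ 2) by ring; ring. Qed.

Lemma is_derive_profileG1 (alpha x : R) :
  is_derive (profileG1 alpha) x (2 * alpha * profileG alpha x - 2 * x * profileG1 alpha x).
Proof.
unfold profileG, profileG1; derive_kummer; replace (x * (x * 1)) with (x ^ 2) by ring.
assert (hq : 0 < 3 / 2) by lra.
(* The odd solution carries a factor [x], so Kummer's equation is multiplied by [x] first; the
   remaining combination is linear. *)
pose proof (f_equal (Rmult x) (kummer_ode (- (alpha / 2) + 1 / 2) (3 / 2) (- x ^ 2) hq)).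
lra.
Qed.

Lemma is_derive_profileH (alpha x : R) :
  is_derive (profileH alpha) x (profileH1 alpha x).
Proof. unfold profileH, profileH1; derive_kummer; replace (x * (x * 1)) with (x ^ 2) by ring; ring. Qed.

Lemma is_derive_profileH1 (alpha x : R) :
  is_derive (profileH1 alpha) x (2 * alpha * profileH alpha x - 2 * x * profileH1 alpha x).
Proof.
unfold profileH, profileH1; derive_kummer; replace (x * (x * 1)) with (x ^ 2) by ring.
assert (hq : 0 < 1 / 2) by lra.
pose proof (f_equal (Rmult (exp (- x ^ 2))) (kummer_ode (alpha / 2 + 1 / 2) (1 / 2) (x ^ 2) hq)).
lra.
Qed.

Lemma profile_ode_intro (alpha xi : R) (P P1 : R -> R) :
  (forall x, is_derive P x (P1 x)) ->
  (forall x, is_derive P1 x (2 * alpha * P x - 2 * x * P1 x)) ->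
  solves_profile_ode alpha xi P P1.
Proof.
intros h h1; split; [|split]; [intros x .. | intros x _; auto];
  eapply is_derive_continuous; eauto.
Qed.

Lemma profileH_pos (alpha x : R) : 0 <= alpha -> 0 < profileH alpha x.
Proof.
intros ha; apply Rmult_lt_0_compat; [apply exp_pos|].
apply Rlt_le_trans with 1; [lra|].
apply kummerM_ge_1; [lra | lra | apply pow2_ge_0].
Qed.

Lemma profileF_0 (alpha : R) : profileF alpha 0 = 1.
Proof. unfold profileF; replace (- 0 ^ 2) with 0 by ring; apply kummerM_0. Qed.

Lemma profileF1_0 (alpha : R) : profileF1 alpha 0 = 0.
Proof. unfold profileF1; ring. Qed.

Lemma profileG1_0 (alpha : R) : profileG1 alpha 0 = 1.
Proof. unfold profileG1; replace (- 0 ^ 2) with 0 by ring; rewrite kummerM_0; ring. Qed.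

Lemma profileH_0 (alpha : R) : profileH alpha 0 = 1.
Proof.
unfold profileH; replace (0 ^ 2) with 0 by ring; rewrite kummerM_0, Ropp_0, exp_0; ring.
Qed.

Lemma profileH1_0 (alpha : R) : profileH1 alpha 0 = 0.
Proof. unfold profileH1; ring. Qed.

(* Kummer's transformation [M p q z = exp z * M (q - p) q (- z)]: both sides
   solve the profile ODE with the same initial data. *)
Lemma profileF_eq_H (alpha x : R) : 0 <= alpha -> 0 <= x ->
  profileF alpha x = profileH alpha x.
Proof.
intros ha hx.
assert (hq : profileF alpha x / profileH alpha x = profileF alpha 0 / profileH alpha 0).
{ apply (profile_proportional alpha x _ (profileF1 alpha) _ (profileH1 alpha));
    try lra; auto using profileF1_0, profileH1_0, profileH_pos;
    apply profile_ode_intro; intros; auto using is_derive_profileF,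
      is_derive_profileF1, is_derive_profileH, is_derive_profileH1. }
rewrite profileF_0, profileH_0 in hq.
pose proof (profileH_pos alpha x ha).
replace (profileF alpha x) with (profileF alpha x / profileH alpha x * profileH alpha x)
  by (field; lra).
rewrite hq; field.
Qed.

(** In the Wronskian identity with [profileH], the left side at [xi] keeps only [P1 xi], the right
    side only [P1 0]; [exp (xi ^ 2)] cancels the exponential in [profileH], and the Kummer factor
    that remains is the inverse of [g]. *)
Lemma profile_end_slope (alpha xi : R) (P P1 : R -> R) :
  0 <= alpha -> 0 <= xi -> solves_profile_ode alpha xi P P1 -> P xi = 0 ->
  P1 xi = P1 0 * g alpha xi.
Proof.
intros ha hxi hP h0.
assert (hH : solves_profile_ode alpha xi (profileH alpha) (profileH1 alpha)).
{ apply profile_ode_intro; intros; auto using is_derive_profileH, is_derive_profileH1. }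
assert (hx : 0 <= xi <= xi) by lra.
pose proof (profile_wronskian _ _ _ _ _ _ xi hP hH hx) as hw.
rewrite h0, profileH1_0, profileH_0 in hw; unfold profileH in hw.
rewrite exp_Ropp in hw.
pose proof (exp_pos (xi ^ 2)).
unfold g.
assert (1 <= kummerM (alpha / 2 + 1 / 2) (1 / 2) (xi ^ 2))
  by (apply kummerM_ge_1; [lra | lra | apply pow2_ge_0]).
set (M := kummerM (alpha / 2 + 1 / 2) (1 / 2) (xi ^ 2)) in *.
transitivity
  (exp (xi ^ 2) * (P1 xi * (/ exp (xi ^ 2) * M) - 0 * profileH1 alpha xi) / M).
- field; lra.
- rewrite hw; field; lra.
Qed.

(** * The function [g] and the equation for the front coefficient *)

Lemma g_le (alpha x y : R) : 0 <= alpha -> 0 <= x <= y -> g alpha y <= g alpha x.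
Proof.
intros ha hxy.
assert (hx : 0 <= x ^ 2) by apply pow2_ge_0.
assert (hxy2 : x ^ 2 <= y ^ 2) by (apply pow_incr; exact hxy).
apply Rinv_le_contravar.
- apply Rlt_le_trans with 1; [lra|]; apply kummerM_ge_1; lra.
- apply kummerM_le; lra.
Qed.

Lemma g_pos (alpha x : R) : 0 <= alpha -> 0 < g alpha x.
Proof.
intros ha; apply Rinv_0_lt_compat, Rlt_le_trans with 1; [lra|].
apply kummerM_ge_1; [lra | lra | apply pow2_ge_0].
Qed.

Lemma g_le_1 (alpha x : R) : 0 <= alpha -> g alpha x <= 1.
Proof.
intros ha; unfold g; rewrite <- Rinv_1; apply Rinv_le_contravar; [lra|].
apply kummerM_ge_1; [lra | lra | apply pow2_ge_0].
Qed.

Lemma continuous_g (alpha x : R) : 0 <= alpha -> continuous (g alpha) x.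
Proof.
intros ha.
apply (continuous_comp (fun x => kummerM (alpha / 2 + 1 / 2) (1 / 2) (x ^ 2)) Rinv).
- eapply is_derive_continuous; derive_kummer; reflexivity.
- apply continuous_Rinv.
  assert (1 <= kummerM (alpha / 2 + 1 / 2) (1 / 2) (x ^ 2))
    by (apply kummerM_ge_1; [lra | lra | apply pow2_ge_0]); lra.
Qed.

(** Existence is the intermediate value theorem; uniqueness holds because the power increases
    strictly while [g] does not increase. *)
Lemma front_equation (alpha K p : R) : 0 <= alpha -> 0 < K -> 0 < p ->
  exists xi, unique (fun z => 0 < z /\ K * g alpha z = Rpower z p) xi.
Proof.
intros ha hK hp.
(* [m < 1] puts [z0] below [1], whence [Rpower z0 p = m < K * g alpha 1 <= K * g alpha z0]. At [z1]
   the power is [K + 1], above [K * g alpha z1] since [g <= 1]. *)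
set (m := Rmin 1 (K * g alpha 1) / 2).
assert (hg1 : 0 < K * g alpha 1) by (apply Rmult_lt_0_compat; auto using g_pos).
assert (hm : 0 < m < 1 /\ m < K * g alpha 1).
{ unfold m, Rmin; destruct (Rle_dec 1 (K * g alpha 1)); lra. }
set (z0 := Rpower m (/ p)); set (z1 := Rpower (K + 1) (/ p)).
assert (hinv : 0 < / p) by (apply Rinv_0_lt_compat, hp).
assert (hz0 : 0 < z0) by (apply exp_pos).
assert (hz01 : z0 < z1).
{ apply Rlt_Rpower_l; lra. }
assert (hz0' : z0 < 1).
{ rewrite <- (Rpower_1 1) by lra.
  replace (Rpower 1 1) with (Rpower 1 (/ p)).
  - apply Rlt_Rpower_l; lra.
  - unfold Rpower; rewrite ln_1; f_equal; ring. }
assert (e0 : Rpower z0 p = m).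
{ unfold z0; rewrite Rpower_mult, Rinv_l, Rpower_1; lra. }
assert (e1 : Rpower z1 p = K + 1).
{ unfold z1; rewrite Rpower_mult, Rinv_l, Rpower_1; lra. }
destruct (IVT_interv (fun z => Rpower z p - K * g alpha z) z0 z1) as [xi [hxi exi]].
- intros z hz; apply continuity_pt_filterlim.
  apply (continuous_minus (fun z => Rpower z p) (fun z => K * g alpha z)).
  + eapply is_derive_continuous, is_derive_Reals, derivable_pt_lim_power; lra.
  + apply (continuous_scal_r K (g alpha)), continuous_g, ha.
- exact hz01.
- rewrite e0.
  assert (g alpha 1 <= g alpha z0) by (apply g_le; lra).
  assert (K * g alpha 1 <= K * g alpha z0) by (apply Rmult_le_compat_l; lra).
  lra.
- rewrite e1.
  assert (K * g alpha z1 <= K * 1) by (apply Rmult_le_compat_l; [lra | apply g_le_1, ha]).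
  lra.
- assert (hlt : forall x y, 0 < x -> x < y ->
      K * g alpha x = Rpower x p -> K * g alpha y = Rpower y p -> False).
  { intros x y hx hxy ex ey.
    assert (Rpower x p < Rpower y p) by (apply Rlt_Rpower_l; lra).
    assert (K * g alpha y <= K * g alpha x)
      by (apply Rmult_le_compat_l; [lra | apply g_le; lra]).
    lra. }
  exists xi; split.
  + split; lra.
  + intros z [hz ez].
    destruct (Rtotal_order xi z) as [h|[h|h]]; [exfalso | exact h | exfalso].
    * apply (hlt xi z); lra.
    * apply (hlt z xi); lra.
Qed.

(** * Calculus relative to a closed interval, and extension to the line by endpoint values *)

Definition clamp (l r x : R) : R := Rmax l (Rmin r x).

Lemma clamp_in (l r x : R) : l <= r -> l <= clamp l r x <= r.
Proof.
intros h; unfold clamp, Rmax, Rmin.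
destruct (Rle_dec r x); destruct (Rle_dec l _); lra.
Qed.

Lemma clamp_id (l r x : R) : l <= x <= r -> clamp l r x = x.
Proof.
intros h; unfold clamp, Rmax, Rmin.
destruct (Rle_dec r x); destruct (Rle_dec l _); lra.
Qed.

Lemma clamp_dist (l r x y : R) : l <= r -> Rabs (clamp l r x - clamp l r y) <= Rabs (x - y).
Proof.
intros h; unfold clamp, Rmax, Rmin.
destruct (Rle_dec r x); destruct (Rle_dec r y);
  repeat match goal with |- context [Rle_dec l ?z] => destruct (Rle_dec l z) end;
  unfold Rabs; repeat destruct (Rcase_abs _); lra.
Qed.

Lemma continuous_clamp (f : R -> R) (l r x : R) : l <= r ->
  (forall y, l <= y <= r -> continue_in f (closed_interval l r) y) ->
  continuous (fun y => f (clamp l r y)) x.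
Proof.
intros hlr hc.
apply (continuity_pt_filterlim (fun y => f (clamp l r y))).
intros eps heps.
destruct (hc (clamp l r x) (clamp_in l r x hlr) eps heps) as [alp [halp h]].
exists alp; split; [exact halp|].
intros y [_ hy].
(* [continue_in] speaks only of points distinct from the base point, but [clamp] may identify [x]
   and [y]; that case is immediate. *)
destruct (Req_dec (clamp l r x) (clamp l r y)) as [e|ne].
- rewrite e; simpl; rewrite Rdist_eq; exact heps.
- apply h; split; [split; [apply (clamp_in l r y hlr) | exact ne]|].
  eapply Rle_lt_trans; [apply clamp_dist, hlr | exact hy].
Qed.

Lemma D_in_is_derive (f d : R -> R) (l r x : R) : l < x < r ->
  D_in f d (closed_interval l r) x -> is_derive f x (d x).
Proof.
intros hx hD; apply is_derive_Reals; intros eps heps.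
destruct (hD eps heps) as [alp [halp h]].
assert (hd : 0 < Rmin alp (Rmin (x - l) (r - x))).
{ repeat apply Rmin_pos; lra. }
exists (mkposreal _ hd); intros y hy0 hy; simpl in hy.
pose proof (Rmin_l alp (Rmin (x - l) (r - x))).
pose proof (Rmin_r alp (Rmin (x - l) (r - x))).
pose proof (Rmin_l (x - l) (r - x)); pose proof (Rmin_r (x - l) (r - x)).
specialize (h (x + y)); simpl in h; unfold Rdist in h.
replace (x + y - x) with y in h by ring.
apply h; split; [|lra].
split; [|lra].
unfold closed_interval; apply Rabs_def2 in hy as [hy1 hy2]; split; lra.
Qed.

Lemma is_derive_D_in (f d : R -> R) (D : R -> Prop) (x : R) :
  is_derive f x (d x) -> D_in f d D x.
Proof.
intros h; apply is_derive_Reals, derivable_pt_lim_D_in in h.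
apply (limit1_imp _ (D_x no_cond x)); [|exact h].
intros y [_ hy]; split; [exact I | exact hy].
Qed.

Lemma is_derive_clamp (f d : R -> R) (l r x : R) : l < x < r ->
  D_in f d (closed_interval l r) x ->
  is_derive (fun y => f (clamp l r y)) x (d x).
Proof.
intros hx hD; apply (is_derive_ext_loc f); [|apply (D_in_is_derive f d l r x hx hD)].
apply (locally_interval _ x l r); simpl; try tauto.
intros y h1 h2; rewrite clamp_id; [reflexivity | lra].
Qed.

(** Every point of a nondegenerate interval is an accumulation point of it, so the difference
    quotient has at most one relative limit. The right endpoint is approached from the left, all
    others from the right. *)
Lemma D_in_unique (f d1 d2 : R -> R) (l r x : R) : l < r -> l <= x <= r ->
  D_in f d1 (closed_interval l r) x -> D_in f d2 (closed_interval l r) x ->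
  d1 x = d2 x.
Proof.
intros hlr hx h1 h2; refine (single_limit _ _ _ _ x _ h1 h2).
intros alp halp.
destruct (Rle_lt_dec r x) as [h|h].
- exists (x - Rmin (alp / 2) (r - l)).
  assert (0 < Rmin (alp / 2) (r - l)) by (apply Rmin_pos; lra).
  pose proof (Rmin_l (alp / 2) (r - l)); pose proof (Rmin_r (alp / 2) (r - l)).
  unfold D_x, closed_interval, Rdist; repeat split; try lra.
  apply Rabs_def1; lra.
- exists (x + Rmin (alp / 2) (r - x)).
  assert (0 < Rmin (alp / 2) (r - x)) by (apply Rmin_pos; lra).
  pose proof (Rmin_l (alp / 2) (r - x)); pose proof (Rmin_r (alp / 2) (r - x)).
  unfold D_x, closed_interval, Rdist; repeat split; try lra.
  apply Rabs_def1; lra.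
Qed.

Lemma D_in_ext (f1 f2 d : R -> R) (D : R -> Prop) (x : R) : D x ->
  (forall y, D y -> f1 y = f2 y) -> D_in f1 d D x -> D_in f2 d D x.
Proof.
intros hx he h eps heps; destruct (h eps heps) as [alp [halp h']].
exists alp; split; [exact halp|].
intros y [[hy hne] hd]; rewrite <- (he y hy), <- (he x hx).
apply h'; repeat split; assumption.
Qed.

(** * Passage between the free boundary problem and its profile *)

Lemma is_derive_sqrt_pos (t : R) : 0 < t -> is_derive sqrt t (/ (2 * sqrt t)).
Proof. intros ht; apply is_derive_Reals, derivable_pt_lim_sqrt, ht. Qed.

(** The similarity variable has time derivative [- eta / (2 t)]; the product rule gives the rest. *)
Lemma is_derive_similarity_time (a alpha : R) (P : R -> R) (x t d : R) :
  0 < a -> 0 < t -> is_derive P (x / (2 * a * sqrt t)) d ->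
  is_derive (fun tau => Rpower tau (alpha / 2) * P (x / (2 * a * sqrt tau))) t
    (Rpower t (alpha / 2) / t *
     (alpha / 2 * P (x / (2 * a * sqrt t)) - x / (2 * a * sqrt t) / 2 * d)).
Proof.
intros ha ht hP.
assert (hs : 0 < sqrt t) by (apply sqrt_lt_R0, ht).
assert (h1 : is_derive (fun tau => Rpower tau (alpha / 2)) t
   (alpha / 2 * Rpower t (alpha / 2 - 1))).
{ apply is_derive_Reals, derivable_pt_lim_power, ht. }
assert (h2 : is_derive (fun tau => x / (2 * a * sqrt tau)) t
   (- (x / (2 * a * sqrt t)) / (2 * t))).
{ assert (hc : is_derive (fun w => x / (2 * a * w)) (sqrt t)
     (- (x / (2 * a * (sqrt t * sqrt t))))).
  { auto_derive; [nra | field; nra]. }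
  eapply is_derive_eq;
    [exact (is_derive_comp (fun w => x / (2 * a * w)) sqrt t _ _ hc
              (is_derive_sqrt_pos t ht))|].
  unfold scal; simpl; unfold mult; simpl.
  replace (2 * t) with (2 * (sqrt t * sqrt t)) by (rewrite sqrt_sqrt; lra); field; lra. }
eapply is_derive_eq.
- refine (is_derive_mult _ (fun tau => P (x / (2 * a * sqrt tau))) t _ _ h1
    (is_derive_comp P (fun tau => x / (2 * a * sqrt tau)) t _ _ hP h2) _).
  exact Rmult_comm.
- unfold plus, mult, scal; simpl; unfold mult; simpl.
  replace (Rpower t (alpha / 2 - 1)) with (Rpower t (alpha / 2) / t).
  + field; lra.
  + unfold Rminus; rewrite Rpower_plus, Rpower_Ropp, Rpower_1 by exact ht; reflexivity.
Qed.

Lemma Rpower_div_sqrt (alpha t : R) : 0 < t ->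
  Rpower t (alpha / 2) / sqrt t = Rpower t ((alpha - 1) / 2).
Proof.
intros ht; rewrite <- Rpower_sqrt by exact ht.
unfold Rdiv; rewrite <- Rpower_Ropp, <- Rpower_plus; f_equal; lra.
Qed.

(** The exponent of [t] is [beta / 2 - (delta + 1) / 2], the same as for the flux when
    [alpha = beta - delta]; hence time drops out of the Stefan condition. *)
Lemma stefan_similarity (a xi beta delta t : R) : 0 < a -> 0 < xi -> 0 < t ->
  Rpower (2 * xi * a * sqrt t) beta * Rpower (xi * a / sqrt t) delta * (xi * a / sqrt t)
  = Rpower 2 beta * Rpower a (beta + delta + 1) * Rpower xi (beta + delta + 1) *
    Rpower t ((beta - delta - 1) / 2).
Proof.
intros ha hxi ht.
assert (hs : 0 < sqrt t) by (apply sqrt_lt_R0, ht).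
assert (hxa : 0 < xi * a) by (apply Rmult_lt_0_compat; lra).
assert (hq : 0 < xi * a / sqrt t) by (apply Rdiv_lt_0_compat; lra).
(* The bare speed factor becomes a first power, so that both sides are single exponentials and only
   their logarithms need comparing. *)
rewrite <- (Rpower_1 (xi * a / sqrt t)) at 2 by exact hq.
assert (e1 : ln (2 * xi * a * sqrt t) = ln 2 + ln xi + ln a + / 2 * ln t).
{ rewrite <- Rpower_sqrt by exact ht.
  rewrite !ln_mult by (repeat apply Rmult_lt_0_compat; try apply exp_pos; lra).
  unfold Rpower; rewrite ln_exp; reflexivity. }
assert (e2 : ln (xi * a / sqrt t) = ln xi + ln a - / 2 * ln t).
{ rewrite <- Rpower_sqrt by exact ht.
  unfold Rdiv; rewrite <- Rpower_Ropp, !ln_mult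
    by (repeat apply Rmult_lt_0_compat; try apply exp_pos; lra).
  unfold Rpower; rewrite ln_exp; ring. }
unfold Rpower; rewrite <- !exp_plus, e1, e2; f_equal; field.
Qed.

(** The factors [2 * a] in the conditions on [P1] come from [eta] having [x]-derivative
    [/ (2 * a * sqrt t)]. *)
Lemma similarity_solves_PN (a k gamma q0 beta delta xi : R) (P P1 : R -> R) :
  0 < a -> 0 < xi ->
  (forall x, is_derive P x (P1 x)) ->
  (forall x, is_derive P1 x (2 * (beta - delta) * P x - 2 * x * P1 x)) ->
  P xi = 0 -> k * P1 0 = - (2 * a * q0) ->
  - k * P1 xi = 2 * a * gamma * Rpower 2 beta * Rpower a (beta + delta + 1)
    * Rpower xi (beta + delta + 1) ->
  solves_PN a k gamma q0 beta delta
    (fun x t => Rpower t ((beta - delta) / 2) * P (x / (2 * a * sqrt t)))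
    (fun t => 2 * xi * a * sqrt t).
Proof.
intros ha hxi hP hP1 h0 hflux hstefan.
set (eta := fun x t : R => x / (2 * a * sqrt t)).
set (c := fun t => Rpower t ((beta - delta) / 2)).
(* The witnesses come from the chain rule. In the second one [P''] is already replaced through the
   profile equation, so the heat equation becomes an algebraic identity. *)
exists (fun x t => c t * (P1 (eta x t) / (2 * a * sqrt t))).
exists (fun x t => c t * ((2 * (beta - delta) * P (eta x t) - 2 * eta x t * P1 (eta x t))
                          / (2 * a * sqrt t) ^ 2)).
exists (fun x t => c t / t * ((beta - delta) / 2 * P (eta x t) - eta x t / 2 * P1 (eta x t))).
exists (fun t => xi * a / sqrt t).
assert (hs : forall t, 0 < t -> 0 < sqrt t) by (intros; apply sqrt_lt_R0; assumption).
assert (hspace : forall (Q : R -> R) x t d, 0 < t -> is_derive Q (eta x t) d ->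
   is_derive (fun y => c t * Q (eta y t)) x (c t * (d / (2 * a * sqrt t)))).
{ intros Q x t d ht hQ; specialize (hs t ht).
  apply is_derive_scal.
  eapply is_derive_eq.
  - apply (is_derive_comp Q (fun y => eta y t) x d (/ (2 * a * sqrt t)) hQ).
    unfold eta; auto_derive; [exact I|field; lra].
  - unfold scal; simpl; unfold mult; simpl; unfold Rdiv; ring. }
refine (conj _ (conj _ (conj _ (conj _ (conj _ (conj _ (conj _ _))))))).
- intros x t ht hx; apply (is_derive_D_in (fun y => c t * P (eta y t)) (fun y => c t * (P1 (eta y t) / (2 * a * sqrt t)))), (hspace P x t _ ht (hP _)).
- intros x t ht hx; split; [|apply is_derive_similarity_time; auto].
  specialize (hs t ht).
  apply (is_derive_ext (fun y => / (2 * a * sqrt t) * (c t * P1 (eta y t)))).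
  + intros y; unfold Rdiv; simpl; ring.
  + eapply is_derive_eq; [apply is_derive_scal, (hspace P1 x t _ ht (hP1 _))|].
    field; lra.
- intros t ht; specialize (hs t ht).
  eapply is_derive_eq; [apply is_derive_scal, is_derive_sqrt_pos, ht | field; lra].
- intros x t ht hx; specialize (hs t ht).
  replace (c t / t) with (c t / (sqrt t * sqrt t)) by (rewrite sqrt_sqrt; lra); field; lra.
- intros t ht; specialize (hs t ht).
  replace (2 * xi * a * sqrt t / (2 * a * sqrt t)) with xi by (field; lra).
  rewrite h0; ring.
- intros t ht; pose proof (hs t ht).
  assert (e : eta (2 * xi * a * sqrt t) t = xi) by (unfold eta; field; lra).
  rewrite e, !Rmult_assoc, <- (Rmult_assoc (Rpower (2 * (xi * (a * sqrt t))) beta)).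
  replace (2 * (xi * (a * sqrt t))) with (2 * xi * a * sqrt t) by ring.
  rewrite stefan_similarity by assumption.
  rewrite <- Rpower_div_sqrt by exact ht; unfold c.
  transitivity ((- k * P1 xi) * (Rpower t ((beta - delta) / 2) / sqrt t) / (2 * a));
    [field; lra|].
  rewrite hstefan; field; lra.
- rewrite sqrt_0; ring.
- intros t ht; pose proof (hs t ht).
  assert (e : eta 0 t = 0) by (unfold eta; field; lra).
  rewrite e, <- Rpower_div_sqrt by exact ht; unfold c.
  transitivity ((k * P1 0) * (Rpower t ((beta - delta) / 2) / sqrt t) / (2 * a));
    [field; lra|].
  rewrite hflux; field; lra.
Qed.

(** The converse passage: the profile equation and its boundary conditions are all read off at one
    well-chosen time [t0]. *)
Lemma similarity_profile (a k gamma q0 beta delta : R) (u : R -> R -> R) (s : R -> R) :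
  0 < a -> solves_PN a k gamma q0 beta delta u s ->
  similarity_type a (beta - delta) u s ->
  exists (xi : R) (P P1 : R -> R),
    0 < xi /\ (forall t, 0 <= t -> s t = 2 * xi * a * sqrt t) /\
    (forall x t, 0 < t -> 0 <= x <= s t ->
       u x t = Rpower t ((beta - delta) / 2) * P (x / (2 * a * sqrt t))) /\
    solves_profile_ode (beta - delta) xi P P1 /\
    P xi = 0 /\ k * P1 0 = - (2 * a * q0) /\
    - k * P1 xi = 2 * a * gamma * Rpower 2 beta * Rpower a (beta + delta + 1)
      * Rpower xi (beta + delta + 1).
Proof.
intros ha [ux [uxx [ut [ds [hux [hd2 [hds [heat [hdir [hstefan [_ hneu]]]]]]]]]]].
intros [xi [phi [hxi [[phi1 [phi2 hphi]] [hs hu]]]]].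
set (P := fun y => phi (clamp 0 xi y)); set (P1 := fun y => phi1 (clamp 0 xi y)).
exists xi, P, P1.
assert (hPphi : forall x, 0 <= x <= xi -> P x = phi x)
  by (intros x hx; unfold P; rewrite clamp_id; [reflexivity | exact hx]).
assert (hP1phi : forall x, 0 <= x <= xi -> P1 x = phi1 x)
  by (intros x hx; unfold P1; rewrite clamp_id; [reflexivity | exact hx]).
assert (hsq : forall t, 0 < t -> 0 < sqrt t) by (intros; apply sqrt_lt_R0; assumption).
assert (hu' : forall x t, 0 < t -> 0 <= x <= s t ->
       u x t = Rpower t ((beta - delta) / 2) * P (x / (2 * a * sqrt t))).
{ intros x t ht hx; rewrite (hu x t ht hx), hPphi; [reflexivity|].
  rewrite hs in hx by lra; specialize (hsq t ht).
  assert (0 < 2 * a * sqrt t) by (apply Rmult_lt_0_compat; lra).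
  split; [apply Rdiv_le_0_compat; lra|].
  apply Rle_div_l; lra. }
(* At this time [x / (2 a sqrt t) = x]. *)
set (t0 := / (4 * a ^ 2)).
assert (ht0 : 0 < t0).
{ apply Rinv_0_lt_compat; pose proof (pow_lt a 2 ha); lra. }
assert (hst0 : sqrt t0 = / (2 * a)).
{ replace t0 with ((/ (2 * a)) * (/ (2 * a))) by (unfold t0; field; lra).
  apply sqrt_square, Rlt_le, Rinv_0_lt_compat; lra. }
assert (h1 : 2 * a * sqrt t0 = 1) by (rewrite hst0; field; lra).
assert (hsxi : s t0 = xi) by (rewrite hs by lra; rewrite hst0; field; lra).
set (c := Rpower t0 ((beta - delta) / 2)).
assert (hc : 0 < c) by apply exp_pos.
assert (hut0 : forall x, 0 <= x <= xi -> u x t0 = c * P x).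
{ intros x hx; rewrite hu' by (rewrite ?hsxi; assumption).
  rewrite h1, Rdiv_1_r; reflexivity. }
(* Uniqueness of the relative derivative gives this at both endpoints too, where the flux and Stefan
   conditions are evaluated. *)
assert (hux0 : forall x, 0 <= x <= xi -> ux x t0 = c * P1 x).
{ intros x hx; rewrite hP1phi by exact hx.
  assert (hx' : 0 <= x <= s t0) by (rewrite hsxi; exact hx).
  pose proof (hux x t0 ht0 hx') as hD; rewrite hsxi in hD.
  apply (D_in_unique (fun y => u y t0) (fun y => ux y t0) (fun y => c * phi1 y) 0 xi x);
    [exact hxi | exact hx | exact hD|].
  apply (D_in_ext (fun y => c * phi y)); [exact hx| |].
  - intros y hy; rewrite hut0, hPphi by exact hy; reflexivity.
  - apply Dmult_const, hphi, hx. }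
assert (hode : solves_profile_ode (beta - delta) xi P P1).
{ split; [|split].
  - intros x; apply continuous_clamp; [lra|].
    intros y hy; apply (cont_deriv phi phi1), hphi, hy.
  - intros x; apply continuous_clamp; [lra|].
    intros y hy; apply (cont_deriv phi1 phi2), hphi, hy.
  - intros x hx.
    assert (hx' : 0 <= x <= xi) by lra.
    assert (hx'' : 0 < x < s t0) by (rewrite hsxi; exact hx).
    destruct (hphi x hx') as [d1 [d2 _]].
    assert (dP : is_derive P x (P1 x)).
    { rewrite hP1phi by exact hx'; apply is_derive_clamp; assumption. }
    assert (dP1 : is_derive P1 x (phi2 x)) by (apply is_derive_clamp; assumption).
    split; [exact dP|].
    eapply is_derive_eq; [exact dP1|].
    destruct (hd2 x t0 ht0 hx'') as [e1 e2].
    assert (exx : uxx x t0 = c * phi2 x).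
    { rewrite <- (is_derive_unique _ _ _ e1).
      apply is_derive_unique.
      apply (is_derive_ext_loc (fun y => c * P1 y)); [|apply is_derive_scal, dP1].
      apply (locally_interval _ x 0 xi); simpl; try tauto.
      intros y hy1 hy2; rewrite hux0 by lra; reflexivity. }
    assert (ett : ut x t0 = c / t0 * ((beta - delta) / 2 * P x - x / 2 * P1 x)).
    { rewrite <- (is_derive_unique _ _ _ e2).
      apply is_derive_unique.
      apply (is_derive_ext_loc (fun tau => Rpower tau ((beta - delta) / 2) *
        P (x / (2 * a * sqrt tau)))).
      (* The similarity form holds only where [x <= s tau]; continuity of [s] keeps the interior
         point [x] inside for [tau] near [t0]. *)
      - assert (hcs : continuous s t0) by (eapply is_derive_continuous, hds, ht0).
        assert (hl1 : locally t0 (fun tau => x < s tau)).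
        { apply (hcs (fun y => x < y)).
          apply (open_gt x); apply hx''. }
        assert (hl2 : locally t0 (fun tau => 0 < tau)) by (apply (open_gt 0); exact ht0).
        generalize (filter_and _ _ hl1 hl2); apply filter_imp.
        intros tau [ha1 ha2]; rewrite hu'; [reflexivity | exact ha2 | lra].
      - eapply is_derive_eq.
        + apply is_derive_similarity_time; [exact ha | exact ht0|].
          rewrite h1, Rdiv_1_r; exact dP.
        + rewrite h1, Rdiv_1_r; reflexivity. }
    pose proof (heat x t0 ht0 hx'') as hh; rewrite exx, ett in hh.
    unfold t0 in hh.
    apply (Rmult_eq_reg_l (a ^ 2 * c)).
    + replace (a ^ 2 * c * phi2 x) with (a ^ 2 * (c * phi2 x)) by ring.
      rewrite <- hh; field; lra.
    + apply Rgt_not_eq, Rmult_lt_0_compat; [apply pow_lt|]; assumption. }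
assert (hpow : Rpower t0 ((beta - delta - 1) / 2) = 2 * a * c).
{ rewrite <- Rpower_div_sqrt, hst0 by exact ht0; fold c; field; lra. }
split; [exact hxi|]; split; [exact hs|]; split; [exact hu'|]; split; [exact hode|].
repeat split.
- pose proof (hdir t0 ht0) as h; rewrite hsxi, hut0 in h by lra.
  apply (Rmult_eq_reg_l c); lra.
- pose proof (hneu t0 ht0) as h; rewrite hux0, hpow in h by lra.
  apply (Rmult_eq_reg_l c); lra.
- pose proof (hstefan t0 ht0) as h; rewrite hsxi, hux0 in h by lra.
  assert (e : ds t0 = xi * a / sqrt t0).
  { rewrite <- (is_derive_unique _ _ _ (hds t0 ht0)).
    apply is_derive_unique.
    apply (is_derive_ext_loc (fun t => 2 * xi * a * sqrt t)).
    - assert (hl : locally t0 (fun tau => 0 < tau)) by (apply (open_gt 0); exact ht0).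
      revert hl; apply filter_imp; intros t ht; rewrite hs; lra.
    - pose proof (hsq t0 ht0).
      eapply is_derive_eq; [apply is_derive_scal, is_derive_sqrt_pos, ht0 | field; lra]. }
  pose proof (stefan_similarity a xi beta delta t0 ha hxi ht0) as es.
  rewrite <- (hs t0), hsxi in es by lra.
  rewrite e in h.
  apply (Rmult_eq_reg_l c); [|lra].
  transitivity (gamma * (Rpower xi beta * Rpower (xi * a / sqrt t0) delta * (xi * a / sqrt t0)));
    [lra|].
  rewrite es, hpow; ring.
Qed.

(** * The explicit solution and its uniqueness *)

Theorem corollary2p1 (a k gamma q0 beta delta : R)
  (ha : 0 < a) (hk : 0 < k) (hgamma : 0 < gamma) (hq0 : 0 < q0)
  (hbd : delta <= beta) (hbd1 : 0 < beta + delta + 1) :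
  let alpha := beta - delta in
  exists xiN : R,
    unique (fun z : R =>
        0 < z /\
        q0 / (gamma * Rpower 2 beta * Rpower a (beta + delta + 1)) * g alpha z
        = Rpower z (beta + delta + 1)) xiN /\
    let C1N := 2 * a * q0 * xiN / k *
      (kummerM (- (alpha / 2) + 1 / 2) (3 / 2) (- xiN ^ 2) /
       kummerM (- (alpha / 2)) (1 / 2) (- xiN ^ 2)) in
    let C2N := - (2 * a * q0 / k) in
    let uN := fun x t : R =>
      let eta := x / (2 * a * sqrt t) in
      Rpower t (alpha / 2) *
      (C1N * kummerM (- (alpha / 2)) (1 / 2) (- eta ^ 2) +
       C2N * eta * kummerM (- (alpha / 2) + 1 / 2) (3 / 2) (- eta ^ 2)) in
    let sN := fun t : R => 2 * xiN * a * sqrt t in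
    solves_PN a k gamma q0 beta delta uN sN /\
    similarity_type a alpha uN sN /\
    (forall (u : R -> R -> R) (s : R -> R),
        solves_PN a k gamma q0 beta delta u s ->
        similarity_type a alpha u s ->
        (forall t, 0 <= t -> s t = sN t) /\
        (forall x t, 0 < t -> 0 <= x <= s t -> u x t = uN x t)).
Proof.
intros alpha.
assert (halpha : 0 <= alpha) by (unfold alpha; lra).
set (L := gamma * Rpower 2 beta * Rpower a (beta + delta + 1)).
assert (hL : 0 < L) by (repeat apply Rmult_lt_0_compat; auto; apply exp_pos).
destruct (front_equation alpha (q0 / L) (beta + delta + 1) halpha) as [xiN hxiN].
{ apply Rdiv_lt_0_compat; assumption. }
{ exact hbd1. }
exists xiN; split; [exact hxiN|].
destruct hxiN as [[hxi exi] huniq].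
intros C1N C2N uN sN.
(* The odd term is associated as in [uN], not as in [profileG], which makes [uN] convertible to the
   similarity form with profile [P]. *)
set (P := fun x => C1N * profileF alpha x + C2N * x *
  kummerM (- (alpha / 2) + 1 / 2) (3 / 2) (- x ^ 2)).
set (P1 := fun x => C1N * profileF1 alpha x + C2N * profileG1 alpha x).
assert (dP : forall x, is_derive P x (P1 x)).
{ intros x; apply (is_derive_ext (fun x => C1N * profileF alpha x + C2N * profileG alpha x)).
  - intros y; unfold P, profileG; simpl; ring.
  - apply (is_derive_plus (fun x => C1N * profileF alpha x)); apply is_derive_scal;
      [apply is_derive_profileF | apply is_derive_profileG]. }
assert (dP1 : forall x, is_derive P1 x (2 * alpha * P x - 2 * x * P1 x)).
{ intros x; eapply is_derive_eq.
  - apply (is_derive_plus (fun x => C1N * profileF1 alpha x)); apply is_derive_scal;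
      [apply is_derive_profileF1 | apply is_derive_profileG1].
  - unfold plus; simpl; unfold P, P1, profileG; ring. }
assert (hode : forall xi, solves_profile_ode alpha xi P P1)
  by (intros xi; apply profile_ode_intro; assumption).
assert (hend : P xiN = 0).
(* The denominator of [C1N] is [profileF alpha xiN], positive by Kummer's transformation; [C1N] is
   the value that makes [P] vanish at [xiN]. *)
{ assert (0 < profileF alpha xiN)
    by (rewrite profileF_eq_H by lra; apply profileH_pos, halpha).
  unfold P, C1N, C2N, profileF in *; field; lra. }
assert (hP10 : k * P1 0 = - (2 * a * q0)).
{ unfold P1, C2N; rewrite profileF1_0, profileG1_0; field; lra. }
assert (hsol : solves_PN a k gamma q0 beta delta uN sN).
{ apply (similarity_solves_PN a k gamma q0 beta delta xiN P P1); auto.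
  assert (hx : 0 <= xiN) by lra.
  (* The end slope is now the flux at [0] times [g], so the Stefan condition is the front equation
     multiplied by [2 * a * L]. *)
  rewrite (profile_end_slope alpha xiN P P1 halpha hx (hode xiN) hend).
  transitivity (- (k * P1 0) * g alpha xiN); [ring|].
  rewrite hP10, !Rmult_assoc, <- exi, <- !Rmult_assoc.
  unfold L; field.
  repeat split; apply Rgt_not_eq; try apply exp_pos; assumption. }
split; [exact hsol|]; split.
- exists xiN, P; split; [exact hxi|]; split.
  + exists P1, (fun x => 2 * alpha * P x - 2 * x * P1 x); intros x hx.
    repeat split.
    * apply is_derive_D_in, dP.
    * apply is_derive_D_in, dP1.
    (* By the equation the second derivative is an expression in [P] and [P1], hence itself
       differentiable and so continuous. *)
    * apply (cont_deriv _ (fun x => Derive (fun x => 2 * alpha * P x - 2 * x * P1 x) x)).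
      apply is_derive_D_in, Derive_correct.
      auto_derive; repeat split; eexists; [apply dP | apply dP1].
  + split; reflexivity.
- intros u s hu hsim.
  destruct (similarity_profile a k gamma q0 beta delta u s ha hu hsim)
    as [xi [Q [Q1 [hxi' [hs [hu' [hQ [hQend [hQ0 hQst]]]]]]]]].
  fold alpha in hQ, hu'.
  assert (hx : 0 <= xi) by lra.
  rewrite (profile_end_slope alpha xi Q Q1 halpha hx hQ hQend) in hQst.
  assert (e : xiN = xi).
  { apply huniq; split; [exact hxi'|].
    apply (Rmult_eq_reg_l (2 * a * L)).
    - transitivity (- (k * Q1 0) * g alpha xi); [rewrite hQ0; field; lra|].
      unfold L; lra.
    - apply Rgt_not_eq; apply Rmult_lt_0_compat; [lra | exact hL]. }
  subst xi.
  split; [exact hs|].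
  intros x t ht hxt; rewrite (hu' x t ht hxt).
  change (uN x t) with (Rpower t (alpha / 2) * P (x / (2 * a * sqrt t))); f_equal.
  rewrite hs in hxt by lra.
  assert (hsq : 0 < sqrt t) by (apply sqrt_lt_R0, ht).
  assert (h2 : 0 < 2 * a * sqrt t) by (apply Rmult_lt_0_compat; lra).
  assert (heta : 0 <= x / (2 * a * sqrt t) <= xiN).
  { split; [apply Rdiv_le_0_compat; lra | apply Rle_div_l; lra]. }
  revert heta; generalize (x / (2 * a * sqrt t)); intros y hy.
  (* The difference of the profiles has zero slope at [0], since both fluxes agree, so it is a
     multiple of [profileH]; vanishing at [xiN], it is zero. *)
  assert (hd : solves_profile_ode alpha xiN (fun x => Q x - P x) (fun x => Q1 x - P1 x)).
  { destruct hQ as [c1 [c2 d]]; destruct (hode xiN) as [c3 [c4 d']].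
    split; [|split].
    - intros z; apply (continuous_minus Q P); auto.
    - intros z; apply (continuous_minus Q1 P1); auto.
    - intros z hz; destruct (d z hz) as [q1 q2]; destruct (d' z hz) as [p1 p2]; split.
      + apply (is_derive_minus Q P); assumption.
      + eapply is_derive_eq; [apply (is_derive_minus Q1 P1); eassumption|].
        unfold minus, plus, opp; simpl; ring. }
  assert (hH : solves_profile_ode alpha xiN (profileH alpha) (profileH1 alpha)).
  { apply profile_ode_intro; intros; auto using is_derive_profileH, is_derive_profileH1. }
  assert (hxx : 0 <= xiN <= xiN) by lra.
  assert (hz : Q1 0 - P1 0 = 0) by (apply (Rmult_eq_reg_l k); lra).
  pose proof (profile_proportional alpha xiN _ _ _ _ y xiN hd hH
    (fun z => profileH_pos alpha z halpha) hz (profileH1_0 alpha) hy hxx) as hp.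
  simpl in hp; rewrite hQend, hend in hp.
  pose proof (profileH_pos alpha y halpha).
  assert (Q y - P y = 0).
  { replace (Q y - P y) with ((Q y - P y) / profileH alpha y * profileH alpha y)
      by (field; lra).
    rewrite hp; unfold Rdiv; ring. }
  lra.
Qed.
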